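(* Let $n\geq 1$ and $k\geq 2$ be integers, let $r$ be a positive integer with $r\leq \frac{(k-1)(2n)}{k}$, and let $\mathcal{F}\subseteq \mathscr{P}^r(M_n)$ be $k$-wise intersecting. Then $$|\mathcal{F}| \leq \begin{cases} 2^{r-1}\binom{n-1}{r-1} & \text{if } r\leq n,\\[2pt] 2^{2n-r}\binom{n-1}{2n-r}+2^{2n-r-1}\binom{n-1}{2n-r-1} & \text{otherwise.}\end{cases}$$ Moreover, if $r<\frac{(k-1)(2n)}{k}$, then equality holds if and only if $\mathcal{F}=\mathscr{P}^r_x(M_n)$ for some $x\in V(M_n)$.
   Context: $M_n$ denotes the perfect matching graph on $2n$ vertices, i.e. the graph with $2n$ vertices and $n$ pairwise disjoint edges. For a graph $G$, let $\alpha(G)$ be its independence number (the size of a maximum independent set). Let $\mathscr{I}(G)$ be the family of all independent vertex sets of $G$, let $\mathscr{M}(G)$ be the family of all vertex sets of $G$ that contain an independent set of size $\alpha(G)$, and let $\mathscr{P}(G)=\mathscr{I}(G)\cup\mathscr{M}(G)$. For a positive integer $r$, $\mathscr{P}^r(G)=\{A\in\mathscr{P}(G): |A|=r\}$, and for a vertex $x\in V(G)$, $\mathscr{P}^r_x(G)=\{A\in \mathscr{P}^r(G): x\in A\}$. A family $\mathcal{F}$ of sets is $k$-wise intersecting if for any $F_1,\ldots,F_k\in\mathcal{F}$ (not necessarily distinct) one has $\bigcap_{i=1}^k F_i\neq\emptyset$. As usual $\binom{a}{b}=0$ when $b>a\ge 0$. *)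

(* Defs.v *)
From mathcomp Require Import all_boot all_order all_algebra.

Set Implicit Arguments.
Unset Strict Implicit.
Unset Printing Implicit Defensive.

(* A finite simple graph is an irreflexive symmetric relation on a finType. *)

Definition indep (T : finType) (e : rel T) (A : {set T}) : bool :=
  [forall x in A, forall y in A, ~~ e x y].

Definition alpha (T : finType) (e : rel T) : nat :=
  \max_(A : {set T} | indep e A) #|A|.

Definition famI (T : finType) (e : rel T) : {set {set T}} :=
  [set A | indep e A].

Definition famM (T : finType) (e : rel T) : {set {set T}} :=
  [set A : {set T} |
    [exists B : {set T}, [&& B \subset A, indep e B & #|B| == alpha e]]].

Definition famP (T : finType) (e : rel T) : {set {set T}} := famI e :|: famM e.

Definition famPr (T : finType) (e : rel T) (r : nat) : {set {set T}} :=
  [set A in famP e | #|A| == r].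

Definition famPrx (T : finType) (e : rel T) (r : nat) (x : T) : {set {set T}} :=
  [set A in famPr e r | x \in A].

(* The k members are indexed by an arbitrary map, so repetitions are allowed. *)
Definition kwise_intersecting (T : finType) (k : nat)
    (F : {set {set T}}) : Prop :=
  forall f : 'I_k -> {set T},
    (forall i, f i \in F) -> \bigcap_(i < k) f i != set0.

(* The edges of M_n are the pairs {(i, false), (i, true)} for i : 'I_n. *)
Definition matching_vertex (n : nat) : finType := ('I_n * bool)%type.

Definition matching (n : nat) : rel (matching_vertex n) :=
  fun u v => (u.1 == v.1) && (u.2 != v.2).

Lemma matching_sym n : symmetric (@matching n).
Proof. by move=> u v; rewrite /matching eq_sym [u.2 == _]eq_sym. Qed.

Lemma matching_irr n : irreflexive (@matching n).
Proof. by move=> u; rewrite /matching !eqxx. Qed.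

Lemma card_matching_vertex n : #|matching_vertex n| = 2 * n.
Proof. by rewrite card_prod card_ord card_bool mulnC. Qed.

(* Main.v *)
(* Katona's cycle method.  Arrange the 2n vertices on a circle with partners
   antipodal: then every arc of r consecutive vertices lies in P^r.  On one such
   circle at most r of the 2n arcs of length r belong to a k-wise intersecting
   family, because k complementary arcs must not cover the circle, and averaging
   over all these circles gives |F| <= |P^r_x|.  If r < (k-1)2n/k and equality
   holds, then on every circle the arcs in F are those through one vertex.  It
   remains to see that this vertex does not depend on the circle.  For r > n the
   complements of the non-members of F have the same property, so r <= n may be
   assumed; then F is intersecting, since two disjoint members are arcs of a
   common circle.  If K + a is in F and K + b is not, every circle on which
   these are consecutive arcs has a as its vertex; choosing it so that some arc
   through a is disjoint from C excludes C from F, for every C avoiding both a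
   and the partner of b.  Applied to several such pairs this leaves only r = n-1,
   where one further circle has no arc in F at all. *)
Require Import Defs.
From mathcomp Require Import all_boot all_order all_algebra all_fingroup.
From mathcomp Require Import zify.

Set Implicit Arguments.
Unset Strict Implicit.
Unset Printing Implicit Defensive.

(** * Periodic sets of positions no $k$ of whose arcs cover the circle *)

Section PeriodicCount.

Variables (N s k : nat) (U : nat -> bool).
Hypotheses (s_gt0 : 0 < s) (k_gt1 : 1 < k) (N_le : N <= k * s).
Hypothesis U_periodic : forall m, U (m + N) = U m.
Hypothesis U_no_cover : forall (b : nat) (f : 'I_k -> nat), (forall i, U (f i)) ->
  exists2 p, p < N & forall i d, d < s -> f i + d <> b + p %[mod N].

Lemma periodic_sum b : \sum_(p < N) U (b + p) = \sum_(p < N) U p.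
Proof.
elim: b => [//|b <-].
case: N U_periodic => [|M] perU; first by rewrite !big_ord0.
rewrite big_ord_recr big_ord_recl /= addn0 addSnnS perU addnC.
by congr (_ + _); apply: eq_bigr => i _; rewrite addSnnS.
Qed.

(* If the whole progression were in U, at most k arcs of length s, started at
   its terms and, when it is too short, at b, would cover the circle. *)
Lemma progression_misses b j : U b -> 0 < j <= s ->
  exists i, [/\ i < k, j + i * s < N & ~~ U (b + (j + i * s))].
Proof.
move=> Ub /andP[j0 js].
case: (boolP [exists i : 'I_k, (j + i * s < N) && ~~ U (b + (j + i * s))]).
  by case/existsP=> i /andP[h1 h2]; exists i.
rewrite negb_exists => /forallP allU.
pose f (i : 'I_k) := if j + i * s < N then b + (j + i * s) else b.
have Uf i : U (f i).
  rewrite /f; case: ifP => // lt; have := allU i.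
  by rewrite lt /= negbK.
have [p pN cov] := U_no_cover b Uf.
case: (leqP j p) => jp.
  have ik : (p - j) %/ s < k by rewrite ltn_divLR //; lia.
  have := cov (Ordinal ik) ((p - j) %% s) (ltn_pmod _ s_gt0).
  rewrite /f /=; have E := divn_eq (p - j) s.
  have -> : j + (p - j) %/ s * s < N by lia.
  by case; congr (_ %% _); lia.
have k1k : k.-1 < k by lia.
case: (leqP N (j + k.-1 * s)) => [h|h].
  have := cov (Ordinal k1k) p; rewrite /f /= (ltnNge (j + _)) h /=.
  by case; lia.
have := cov (Ordinal k1k) (N + p - (j + k.-1 * s)); rewrite /f /= h.
case; first by nia.
by rewrite -(modnDr (b + p)); congr (_ %% _); lia.
Qed.

(** The progressions in [progression_misses] start at offsets $1,\dots,s$, hence the shift by 1.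
    Truncation also sends offset 0 to class 0, but 0 is not in [missing b] once [U b] holds. *)
Let residue (p : 'I_N) : 'I_s := Ordinal (ltn_pmod (p - 1) s_gt0).

Let missing b := [set p : 'I_N | ~~ U (b + p)].

Lemma residue_onto b : U b -> residue @: missing b = setT.
Proof.
move=> Ub; apply/setP=> j; rewrite inE.
have [|i [_ lt nU]] := @progression_misses b j.+1 Ub; first by have := ltn_ord j; lia.
apply/imsetP; exists (Ordinal lt); first by rewrite inE.
by apply: val_inj; rewrite /= addSn subn1 /= addnC modnMDl modn_small.
Qed.

Lemma sum_missing b : \sum_(p < N) U p + #|missing b| = N.
Proof.
rewrite -(periodic_sum b) -sum1_card [X in _ + X]big_mkcond /= -big_split /=.
rewrite -[RHS]card_ord -sum1_card; apply: eq_bigr => p _.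
by rewrite inE; case: (U _).
Qed.

(** Seen from a member [b], each of the $s$ residue classes contains a missing offset, so at least
    $s$ offsets are missing. *)
Lemma periodic_count_le : s <= N -> \sum_(p < N) U p <= N - s.
Proof.
move=> sN; case: (boolP [exists p : 'I_N, U p]) => [/existsP[b Ub]|].
  have := leq_imset_card residue (missing b).
  rewrite (residue_onto Ub) cardsT card_ord; have := sum_missing b; lia.
rewrite negb_exists => /forallP noU.
by rewrite big1 // => i _; rewrite (negbTE (noU i)).
Qed.

(** With exactly $s$ missing offsets, each residue class contains exactly one. Seen from a member
    [b] followed by a non-member, these must be the offsets $1,\dots,s$: a member among them would
    again give $k$ arcs covering the circle. *)
Lemma periodic_count_eq : s < N -> N < k * s ->
    \sum_(p < N) U p = N - s ->
  exists b, forall p, p < N -> U (b + p) = ~~ (0 < p <= s).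
Proof.
move=> sN N_lt sumU.
have [b Ub nUb] : exists2 b, U b & ~~ U b.+1.
  have [b Ub] : exists b : 'I_N, U b.
    apply/existsP; apply: contraPT sumU; rewrite negb_exists => /forallP noU.
    rewrite big1 ?addn0 => [|i _]; [lia|by rewrite (negbTE (noU i))].
  have : [exists p : 'I_N, ~~ U (b + p)].
    apply: contraPT sumU; rewrite negb_exists => /forallP allU.
    rewrite -(periodic_sum b) (eq_bigr (fun=> 1)) => [|i _].
      by rewrite sum1_card card_ord; lia.
    by have := allU i; rewrite negbK => ->.
  case/existsP=> p; elim: {p}(p : nat) => [|p IH]; first by rewrite addn0 Ub.
  rewrite addnS; case: (boolP (U (b + p))) => [Up nU|nU _]; last exact: IH.
  by exists (b + p).
exists b.
have inj : {in missing b &, injective residue}.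
  apply/imset_injP; rewrite (residue_onto Ub) cardsT card_ord.
  have := sum_missing b; rewrite sumU; lia.
have run j : j < s -> ~~ U (b + j.+1).
  elim: j => [|j IH] js; first by rewrite addn1.
  apply/negP => Uj; have nU := IH (ltnW js).
  (* Class [j] has its only missing offset at [j.+1], so the later terms of the progression are in
     [U], and its first term is replaced by [j.+2]. Offset [j.+1], lost by this shift, is covered by
     the arc at [b] or, since [N < k * s] is strict, by the last arc going round. *)
  pose f (i : 'I_k) := if i == 0 :> nat then b + j.+2 else
    if j.+1 + i * s < N then b + (j.+1 + i * s) else b.
  have Uf i : U (f i).
    rewrite /f; case: eqP => // /eqP i0; case: ifP => // lt.
    apply: contraT => nUi.
    have jN : j.+1 < N by lia.
    have := inj (Ordinal lt) (Ordinal jN); rewrite !inE => /(_ nUi nU) E.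
    have : Ordinal lt = Ordinal jN.
      apply: E; apply: val_inj => /=.
      by rewrite addSn !subn1 /= addnC modnMDl.
    move/(congr1 val) => /=; have : 0 < i * s by rewrite muln_gt0 s_gt0 lt0n i0.
    lia.
  have [p pN cov] := U_no_cover b Uf.
  case: (leqP j.+2 p) => jp.
    have ik : (p - j.+1) %/ s < k by rewrite ltn_divLR //; lia.
    have E := divn_eq (p - j.+1) s.
    case: (posnP ((p - j.+1) %/ s)) => q0.
      have := cov (Ordinal ik) ((p - j.+1) - 1).
      rewrite /f /= q0 /=; case; first by have := ltn_pmod (p - j.+1) s_gt0; lia.
      by congr (_ %% _); lia.
    have := cov (Ordinal ik) ((p - j.+1) %% s) (ltn_pmod _ s_gt0).
    rewrite /f /= -[_ == 0]negbK -lt0n q0 /=.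
    have -> : j.+1 + (p - j.+1) %/ s * s < N by lia.
    by case; congr (_ %% _); lia.
  have k1k : k.-1 < k by lia.
  have k10 : (k.-1 == 0) = false by apply/eqP; lia.
  case: (leqP N (j.+1 + k.-1 * s)) => [h|h].
    have := cov (Ordinal k1k) p; rewrite /f /= k10 (ltnNge (j.+1 + _)) h /=.
    by case; lia.
  have := cov (Ordinal k1k) (N + p - (j.+1 + k.-1 * s)); rewrite /f /= k10 h.
  case; first by nia.
  by rewrite -(modnDr (b + p)); congr (_ %% _); lia.
move=> p pN; case: (posnP p) => [->|p0]; first by rewrite addn0 Ub.
case: (leqP p s) => ps /=; first by rewrite -(prednK p0) (negbTE (run _ _)) //; lia.
apply: contraT => nU.
have jN : ((p - 1) %% s).+1 < N by have := ltn_pmod (p - 1) s_gt0; lia.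
have := inj (Ordinal pN) (Ordinal jN); rewrite !inE => /(_ nU (run _ (ltn_pmod _ s_gt0))) E.
have : Ordinal pN = Ordinal jN.
  by apply: E; apply: val_inj => /=; rewrite subn1 /= subSS subn0 modn_mod.
by move/(congr1 val) => /=; have := ltn_pmod (p - 1) s_gt0; lia.
Qed.

End PeriodicCount.

(** * Independent sets of $M_n$, antipodal orders and their arcs *)

Lemma matching_indepP n (A : {set matching_vertex n}) :
  reflect {in A &, forall x y, x.1 = y.1 -> x = y} (indep (@matching n) A).
Proof.
apply: (iffP forall_inP) => [indA x y xA yA e1|inj x xA].
  have /forall_inP/(_ y yA) := indA x xA; rewrite /matching e1 eqxx /= negbK.
  by move/eqP; case: x y e1 {xA yA} => i a [j b] /= -> ->.
apply/forall_inP => y yA; rewrite /matching negb_and negbK.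
by case: eqP => //= /(inj x y xA yA) ->.
Qed.

Definition star n (u : matching_vertex n) : matching_vertex n := (u.1, ~~ u.2).

Lemma starK n : involutive (@star n).
Proof. by case=> i b; rewrite /star /= negbK. Qed.

Lemma star_neq n (u : matching_vertex n) : star u != u.
Proof. by apply/eqP => /(congr1 snd) /=; case: u.2. Qed.

Lemma star1 n (u : matching_vertex n) : (star u).1 = u.1. Proof. by []. Qed.

Lemma eq_or_star n (u v : matching_vertex n) : u.1 = v.1 -> u = v \/ u = star v.
Proof.
case: u v => [i a] [j b] /= ->; rewrite /star /=.
by case: a b => [] []; [left|right|right|left].
Qed.

Lemma indep_starF n (A : {set matching_vertex n}) u :
  indep (@matching n) A -> u \in A -> star u \in A -> False.
Proof.
move=> /matching_indepP indA uA suA.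
by move: (star_neq u); rewrite (indA _ _ suA uA (star1 u)) eqxx.
Qed.

(* A cyclic order of the 2n vertices in which partners are antipodal, unrolled
   to a sequence of period 2n. *)
Definition antipodal n (v : nat -> matching_vertex n) :=
  (forall j, v (j + n) = star (v j)) /\
  (forall i j, (v i).1 = (v j).1 -> i = j %[mod n]).

Definition carc n (v : nat -> matching_vertex n) (m l : nat) :=
  [set v (m + i) | i : 'I_l].

Section Antipodal.

Variables (n : nat) (v : nat -> matching_vertex n).

Lemma arcP m l x :
  reflect (exists2 i, i < l & x = v (m + i)) (x \in carc v m l).
Proof.
apply: (iffP imsetP) => [[i _ ->]|[i il ->]]; first by exists i.
by exists (Ordinal il).
Qed.

Lemma mem_arc m l i : m <= i < m + l -> v i \in carc v m l.
Proof.
by move=> /andP[mi il]; apply/arcP; exists (i - m); [lia|rewrite subnKC].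
Qed.

Lemma arc_recl m l : carc v m l.+1 = v m |: carc v m.+1 l.
Proof.
apply/setP=> x; rewrite in_setU1; apply/arcP/orP.
  case=> [] [|i] il ->; first by left; rewrite addn0.
  by right; apply/arcP; exists i => //; rewrite addSnnS.
case=> [/eqP ->|/arcP[i il ->]]; first by exists 0; rewrite ?addn0.
by exists i.+1 => //; rewrite addSnnS.
Qed.

Lemma arc_recr m l : carc v m l.+1 = v (m + l) |: carc v m l.
Proof.
apply/setP=> x; rewrite in_setU1; apply/arcP/orP.
  case=> i; rewrite ltnS leq_eqVlt => /orP[/eqP -> -> |il ->]; first by left.
  by right; apply/arcP; exists i.
by case=> [/eqP ->|/arcP[i il ->]]; [exists l|exists i => //; apply: ltnW].
Qed.

Hypothesis vP : antipodal v.

Lemma antipodalD j : v (j + n) = star (v j). Proof. exact: vP.1. Qed.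

Lemma antipodalM i q : v (i + q * n) = if odd q then star (v i) else v i.
Proof.
elim: q => [|q IH]; first by rewrite addn0.
rewrite mulSn addnCA addnC antipodalD IH /=.
by case: odd; rewrite //= starK.
Qed.

Lemma antipodal_eq1 i j : (v i).1 = (v j).1 <-> i = j %[mod n].
Proof.
split=> [|E]; first exact: vP.2.
have fE k : (v k).1 = (v (k %% n)).1.
  by rewrite {1}(divn_eq k n) addnC antipodalM; case: odd.
by rewrite fE E -fE.
Qed.

Lemma antipodal_eq i j : v i = v j <-> i = j %[mod 2 * n].
Proof.
have red : forall k, v k = v (k %% (2 * n)).
  move=> k; rewrite {1}(divn_eq k (2 * n)) addnC mulnA antipodalM.
  by rewrite mulnC oddM.
split=> [E|E]; last by rewrite red E -red.
have n0 : 0 < n by case: (v 0).1 => m; case: n.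
rewrite red (red j) in E.
have : i %% (2 * n) < 2 * n by rewrite ltn_pmod ?muln_gt0.
have : j %% (2 * n) < 2 * n by rewrite ltn_pmod ?muln_gt0.
move: (i %% _) (j %% _) E => a b E.
wlog ab : a b E / a <= b => [W b2 a2|b2 a2].
  by case: (leqP a b) => [|/ltnW] ab; [apply: W|apply/esym; apply: W].
have /eqP : b = a %[mod n] by apply/antipodal_eq1; rewrite E.
(* Here $b - a$ is a multiple of $n$ below $2n$; the multiple $n$ itself would make a vertex its own
   partner. *)
rewrite eqn_mod_dvd // => /dvdnP[[|[|q]] Eq]; [lia| |nia].
by move: (star_neq (v a)); rewrite -antipodalD E; case/eqP; congr v; lia.
Qed.

Lemma antipodalDN j : v (j + 2 * n) = v j.
Proof. by apply/antipodal_eq; rewrite modnDr. Qed.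

Lemma arcDN m l : carc v (m + 2 * n) l = carc v m l.
Proof. by apply: eq_imset => i; rewrite addnAC antipodalDN. Qed.

Lemma arcDn m l : carc v (m + n) l = @star n @: carc v m l.
Proof. by rewrite -imset_comp; apply: eq_imset => i /=; rewrite addnAC antipodalD. Qed.

Lemma antipodal_inj b i j : i < 2 * n -> j < 2 * n -> v (b + i) = v (b + j) -> i = j.
Proof.
by move=> i2 j2 /antipodal_eq/eqP; rewrite eqn_modDl !modn_small // => /eqP.
Qed.

Lemma antipodal_onto b x : exists2 p, p < 2 * n & x = v (b + p).
Proof.
pose g (p : 'I_(2 * n)) := v (b + p).
have gI : injective g by move=> p q /antipodal_inj E; apply: val_inj; apply: E.
have : x \in codom g by apply: inj_card_onto; rewrite // card_matching_vertex card_ord.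
by case/codomP=> p ->; exists p.
Qed.

Lemma mem_arcE m l p : l <= 2 * n -> p < 2 * n -> (v (m + p) \in carc v m l) = (p < l).
Proof.
move=> l2 p2; apply/arcP/idP => [[i il /antipodal_inj -> //]|]; first by lia.
by exists p.
Qed.

Lemma card_arc m l : l <= 2 * n -> #|carc v m l| = l.
Proof.
move=> l2; rewrite card_imset ?card_ord // => i j /antipodal_inj E.
by apply: val_inj; apply: E; apply: leq_trans (ltn_ord _) l2.
Qed.

Lemma arc_setC m l : l <= 2 * n -> ~: carc v m l = carc v (m + l) (2 * n - l).
Proof.
move=> l2; apply/setP=> x; have [p p2 ->] := antipodal_onto m x.
rewrite inE mem_arcE //; case: ltnP => pl /=; apply/esym.
  apply/negbTE/arcP => -[i il]; rewrite -addnA => /antipodal_inj E.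
  by have := E p2; lia.
by apply: mem_arc; lia.
Qed.

Lemma indep_arc m l : l <= n -> indep (@matching n) (carc v m l).
Proof.
move=> ln; apply/matching_indepP => x y /arcP[i il ->] /arcP[j jl ->].
move=> /antipodal_eq1/eqP.
by rewrite eqn_modDl !modn_small ?(leq_trans il) ?(leq_trans jl) // => /eqP ->.
Qed.

End Antipodal.

(** * Construction of antipodal orders with a prescribed beginning *)

Lemma antipodal_shift n (v : nat -> matching_vertex n) q :
  antipodal v -> antipodal (fun j => v (q + j)).
Proof.
move=> [vD v1]; split=> [j|i j /v1/eqP]; first by rewrite addnA vD.
by rewrite eqn_modDl => /eqP.
Qed.

Lemma arc_shift n (v : nat -> matching_vertex n) q m l :
  carc (fun j => v (q + j)) m l = carc v (q + m) l.
Proof. by apply: eq_imset => i; rewrite addnA. Qed.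

(** Half a circle determines the rest, because each further half turn applies [star] once more. *)
Lemma antipodal_of_seq n (L : seq (matching_vertex n)) :
  0 < n -> size L = n -> uniq (map fst L) ->
  exists2 v, antipodal v & forall x0 j, j < n -> v j = nth x0 L j.
Proof.
move=> n0 sL uL; pose x1 : matching_vertex n := (Ordinal n0, true).
exists (fun j => iter (j %/ n) (@star n) (nth x1 L (j %% n))); last first.
  by move=> x0 j jn; rewrite divn_small // modn_small //=; apply: set_nth_default; rewrite sL.
split=> [j|i j]; first by rewrite modnDr divnDr // divnn n0 addn1.
have it1 k u : (iter k (@star n) u).1 = u.1 by elim: k => //= k ->.
have jn k : k %% n < size L by rewrite sL ltn_pmod.
rewrite !it1 -!(nth_map x1 x1.1) // => /eqP.
by rewrite nth_uniq ?size_map // => /eqP.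
Qed.

Lemma complete_transversal n (L : seq (matching_vertex n)) (Q : pred (matching_vertex n)) :
  uniq (map fst L) -> (forall u, Q u || Q (star u)) ->
  exists R, [/\ all Q R, uniq (map fst (L ++ R)) & size (L ++ R) = n].
Proof.
move=> uL Q2; pose S := [seq i <- enum 'I_n | i \notin map fst L].
exists [seq (i, Q (i, true)) | i <- S].
have E : map fst (L ++ [seq (i, Q (i, true)) | i <- S]) = map fst L ++ S.
  by rewrite map_cat -map_comp map_id.
have uE : uniq (map fst L ++ S).
  rewrite cat_uniq uL filter_uniq ?enum_uniq // andbT; apply/hasPn => i.
  by rewrite mem_filter => /andP[].
split; last 1 first.
- rewrite -(size_map fst) E -(card_uniqP uE) -[RHS]card_ord.
  by apply: eq_card => i; rewrite mem_cat mem_filter mem_enum inE andbT orbN.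
- apply/allP => _ /mapP[i _ ->]; have := Q2 (i, true); rewrite /star /=.
  by case: (boolP (Q (i, true))).
by rewrite E.
Qed.

Lemma indep_uniq_fst n (X : {set matching_vertex n}) (L : seq (matching_vertex n)) :
  indep (@matching n) X -> {subset L <= X} -> uniq L -> uniq (map fst L).
Proof.
move=> /matching_indepP indX LX uL; rewrite map_inj_in_uniq // => x y /LX xX /LX yX.
exact: indX.
Qed.

(** On each edge not met by [L], one endpoint satisfies [Q]; these endpoints fill the first
    half-circle after [L]. *)
Lemma antipodal_extend n (L : seq (matching_vertex n)) (Q : pred (matching_vertex n)) x0 :
  0 < n -> uniq (map fst L) -> (forall u, Q u || Q (star u)) ->
  exists v, [/\ antipodal v, forall j, j < size L -> v j = nth x0 L j &
                forall j, size L <= j < n -> Q (v j)].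
Proof.
move=> n0 uL Q2; have [R [allQ uLR sLR]] := complete_transversal uL Q2.
have [v vP vE] := antipodal_of_seq n0 sLR uLR.
exists v; split=> // j jL.
  by rewrite (vE x0) ?nth_cat ?jL // -sLR size_cat ltn_addr.
have /andP[j1 j2] := jL.
rewrite (vE x0) // nth_cat ltnNge j1 /=; apply: (allP allQ).
by apply: mem_nth; rewrite ltn_subLR // -size_cat sLR.
Qed.

Lemma arc_seq n (v : nat -> matching_vertex n) l1 l2 l3 x0 :
  (forall j, j < size (l1 ++ l2 ++ l3) -> v j = nth x0 (l1 ++ l2 ++ l3) j) ->
  carc v (size l1) (size l2) = [set x in l2].
Proof.
rewrite !size_cat => vE.
have vE2 i : i < size l2 -> v (size l1 + i) = nth x0 l2 i.
  move=> il; rewrite vE; last by lia.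
  by rewrite !nth_cat ltnNge leq_addr /= addKn il.
apply/setP=> x; rewrite inE; apply/arcP/idP => [[i il ->]|xl].
  by rewrite vE2 // mem_nth.
by exists (index x l2); rewrite ?vE2 ?index_mem // nth_index.
Qed.

(** * The common vertex does not depend on the circle, for independent sets *)

Section Gluing.

Variables (n t : nat) (G : {set {set matching_vertex n}}).
Hypotheses (t_gt0 : 0 < t) (t_le : t <= n).
Hypothesis G_indep : forall C, C \in G -> indep (@matching n) C.
Hypothesis G_card : forall C, C \in G -> #|C| = t.
Hypothesis G_star : forall v, antipodal v ->
  exists x, forall m, (carc v m t \in G) = (x \in carc v m t).

Let n_gt0 : 0 < n := leq_trans t_gt0 t_le.

(* Two disjoint members of G would be arcs of a common antipodal order. *)
Lemma G_meet C D : C \in G -> D \in G -> exists2 u, u \in C & u \in D.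
Proof.
move=> CG DG; case: (set_0Vmem (C :&: D)) => [dis|[u /setIP[uC uD]]]; last by exists u.
have indC := G_indep CG; have indD := G_indep DG.
have disF u : u \in C -> u \in D -> False.
  by move=> uC uD; have := in_set0 u; rewrite -dis inE uC uD.
pose E := @star n @: D.
have inE' u : (u \in E) = (star u \in D).
  by rewrite -{1}(starK u) mem_imset //; apply: inv_inj (@starK n).
have indX : indep (@matching n) (C :|: E).
  apply/matching_indepP => x y; rewrite !in_setU !inE' => xX yX e1.
  have /matching_indepP iC := indC; have /matching_indepP iD := indD.
  case: (eq_or_star e1) xX yX => // ->; rewrite starK.
  case/orP=> h1 /orP[] h2; try by [case: (disF _ h1 h2)|case: (disF _ h2 h1)].
    by case: (indep_starF indC h2).
  by case: (indep_starF indD h1).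
(* In the order [l1], [l2], [l3], the set [C] is the arc [l1 ++ l2] and [E] is the arc [l2 ++ l3];
   [D] is the arc opposite to [E]. Both [C] and [D] then contain the vertex of this circle. *)
set l1 := enum (C :\: E); set l2 := enum (C :&: E); set l3 := enum (E :\: C).
have uL : uniq (l1 ++ l2 ++ l3).
  rewrite !cat_uniq !enum_uniq /= andbT; apply/andP; split.
    apply/hasPn => u; rewrite mem_cat !mem_enum !inE.
    by case: (u \in C); case: (u \in E).
  by apply/hasPn => u; rewrite !mem_enum !inE; case: (u \in C); case: (u \in E).
have LX : {subset l1 ++ l2 ++ l3 <= C :|: E}.
  move=> u; rewrite !mem_cat !mem_enum !inE.
  by case: (u \in C); case: (u \in E).
have [u0 _] : exists u, u \in C by apply/card_gt0P; rewrite (G_card CG).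
have [|v [vP vE _]] := @antipodal_extend n _ predT u0 n_gt0 (indep_uniq_fst indX LX uL).
  by [].
have aC : carc v 0 t = C.
  have := @arc_seq n v [::] (l1 ++ l2) l3 u0; rewrite -catA => /(_ vE).
  rewrite size_cat -!cardE addnC cardsID (G_card CG) => ->.
  by apply/setP=> u; rewrite inE mem_cat !mem_enum !inE; case: (u \in C); case: (u \in E).
have aD : carc v (size l1 + n) t = D.
  have := @arc_seq n v l1 (l2 ++ l3) [::] u0; rewrite cats0 => /(_ vE).
  rewrite size_cat -!cardE setIC cardsID card_imset; last exact: inv_inj (@starK n).
  rewrite (G_card DG) => aE; rewrite arcDn // aE; apply/setP=> u.
  rewrite -{1}(starK u) mem_imset; last exact: inv_inj (@starK n).
  rewrite inE mem_cat !mem_enum !inE inE' starK.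
  by case: (_ \in C); case: (_ \in D).
have [x xP] := G_star vP; exists x; first by rewrite -aC -xP aC.
by rewrite -aD -xP aD.
Qed.

(* The vertices l1 = a :: enum (K :\: C) in front and the partners of the rest
   form n consecutive positions around a avoiding C; an arc there is in G. *)
Lemma transition_core a (K : {set matching_vertex n}) b C l :
  a \notin K -> a |: K \in G -> b |: K \notin G -> C \in G -> a \notin C ->
  all [pred u | star u \notin C] l ->
  uniq (map fst (a :: enum (K :\: C) ++ enum (K :&: C) ++ l)) ->
  (forall v, antipodal v ->
     (forall j, j < size (a :: enum (K :\: C) ++ enum (K :&: C) ++ l) ->
        v j = nth a (a :: enum (K :\: C) ++ enum (K :&: C) ++ l) j) -> v t = b) ->
  False.
Proof.
move=> aK aKG bKG CG aC /allP lC uL vtb.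
set k1 := enum (K :\: C) in uL vtb; set k2 := enum (K :&: C) in uL vtb.
have indC := G_indep CG.
pose Q u := star u \notin C.
have Q2 u : Q u || Q (star u).
  rewrite /Q starK -negb_and; apply/negP => /andP[h1 h2].
  exact: indep_starF indC h2 h1.
have [v [vP vE vQ]] := antipodal_extend a n_gt0 uL Q2.
have vt := vtb v vP vE.
have v0 : v 0 = a by rewrite vE.
have tK : #|K|.+1 = t by rewrite -(G_card aKG) cardsU1 aK.
have aKarc : carc v 1 #|K| = K.
  have := @arc_seq n v [:: a] (k1 ++ k2) l a; rewrite -catA => /(_ vE).
  rewrite size_cat -!cardE addnC cardsID => ->.
  by apply/setP=> u; rewrite inE mem_cat !mem_enum !inE; case: (u \in C); case: (u \in K).
have arc0 : carc v 0 t = a |: K by rewrite -tK arc_recl aKarc v0.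
have arc1 : carc v 1 t = b |: K by rewrite -tK arc_recr aKarc add1n tK vt.
have [x xP] := G_star vP.
have xa : x = a.
  have : x \in a |: K by rewrite -arc0 -xP arc0.
  rewrite in_setU1 => /orP[/eqP //|xK].
  by have := xP 1; rewrite arc1 (negbTE bKG) in_setU1 xK orbT.
have front j : j <= size k1 -> v j \notin C.
  move=> jk; rewrite vE; last by rewrite /= size_cat ltnS (leq_trans jk) ?leq_addr.
  case: j jk => [|j jk] //=; rewrite nth_cat jk.
  have := mem_nth a jk; rewrite mem_enum !inE.
  by case/andP.
have back j : size k1 < j < n -> star (v j) \notin C.
  move=> /andP[jk jn]; case: (ltnP j (size (a :: k1 ++ k2 ++ l))) => jL; last first.
    by apply: (vQ j); rewrite jL.
  rewrite vE //; case: j jk jn jL => //= j jk _ jL.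
  rewrite nth_cat ltnNge -ltnS jk /=.
  have /(mem_nth a) : j - size k1 < size (k2 ++ l) by rewrite ltn_subLR -?size_cat.
  rewrite mem_cat => /orP[|/lC //]; rewrite mem_enum inE => /andP[_ h].
  by apply/negP; apply: indep_starF indC h.
have k1t : size k1 < t.
  by rewrite -cardE -tK ltnS subset_leq_card // subsetDl.
(* This arc ends at position [size k1] of the next turn. It contains [a] at position $2n$ because
   [size k1 < t], and it starts after $n$ + [size k1] because $t \le n$, so [back] and [front] keep
   it disjoint from [C]. *)
have DG : carc v (2 * n - t + (size k1).+1) t \in G.
  rewrite xP xa -v0 -(antipodalDN vP) add0n; apply: mem_arc; lia.
have [u uC /arcP[i it Eu]] := G_meet CG DG.
move: uC; rewrite Eu; set p := _ + _.
case: (ltnP p (2 * n)) => pn; apply/negP.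
  have -> : p = (p - n) + n by rewrite /p; lia.
  by rewrite antipodalD //; apply: back; rewrite /p in pn *; lia.
have -> : p = (p - 2 * n) + 2 * n by lia.
by rewrite antipodalDN //; apply: front; rewrite /p in pn *; lia.
Qed.

(** Independence of all $t+1$ vertices allows [a], [K], [b] to be consecutive in one half-circle; it
    forces $t < n$. *)
Definition transition a (K : {set matching_vertex n}) b :=
  [/\ indep (@matching n) (b |: (a |: K)), a \notin K, b \notin a |: K,
      a |: K \in G & b |: K \notin G].

(** If [star b] were also outside [C], then [b] could be placed at position [t] without its antipode
    meeting [C], and [transition_core] would apply. *)
Lemma transition_star a K b C :
  transition a K b -> C \in G -> a \notin C -> star b \in C.
Proof.
case=> indX aK baK aKG bKG CG aC; apply: contraT => sbC.
have tK : #|K|.+1 = t by rewrite -(G_card aKG) cardsU1 aK.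
have Esize : size (enum (K :\: C)) + size (enum (K :&: C)) = #|K|.
  by rewrite -!cardE addnC cardsID.
case: (@transition_core a K b C [:: b]) => //; first by rewrite /= sbC.
  apply: (indep_uniq_fst indX).
    move=> u; rewrite !inE !mem_cat !mem_enum !inE.
    case: (u \in K); rewrite ?orbT //=.
    by rewrite ?andbF /= => /orP[] ->; rewrite ?orbT.
  rewrite /= !mem_cat !mem_enum !cat_uniq !enum_uniq !inE /= !mem_enum !inE.
  rewrite in_setU1 negb_or in baK; case/andP: baK => ba bK.
  rewrite (negbTE aK) (negbTE bK) /= !andbF /= eq_sym (negbTE ba) /= andbT.
  apply/hasPn => u; rewrite mem_cat !mem_enum !inE => /orP[/andP[_ ->] //|/eqP ->].
  by rewrite (negbTE bK) andbF.
move=> v vP vE; rewrite vE -tK; last by rewrite /= !size_cat /= addnA Esize addn1.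
by rewrite /= -Esize catA -size_cat nth_cat ltnn subnn.
Qed.

(** For $t = n$ the vertex after [K] is the antipode of [a], so nothing has to be placed beyond [K]
    and no condition on the partner of [b] arises. *)
Lemma full_transition a (K : {set matching_vertex n}) C : t = n -> a \notin K ->
  a |: K \in G -> star a |: K \notin G -> C \in G -> a \in C.
Proof.
move=> tn aK aKG bKG CG; apply: contraT => aC.
have indX := G_indep aKG.
case: (@transition_core a K (star a) C [::]) => //.
  rewrite cats0; apply: (indep_uniq_fst indX).
    move=> u; rewrite !inE !mem_cat !mem_enum !inE.
    by case: (u \in K); rewrite ?orbT //= !andbF.
  rewrite /= mem_cat !mem_enum cat_uniq !enum_uniq !inE (negbTE aK) !andbF /= andbT.
  by apply/hasPn => u; rewrite !mem_enum !inE => /andP[_ ->].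
by move=> v vP vE; rewrite tn; have := antipodalD vP 0; rewrite add0n (vE 0).
Qed.

Lemma transition_intro a (K : {set matching_vertex n}) b :
  a \notin K -> (forall y, y \in a |: K -> y.1 != b.1) ->
  a |: K \in G -> b |: K \notin G -> transition a K b.
Proof.
move=> aK yb aKG bKG; split=> //; last by apply/negP => /yb; rewrite eqxx.
have /matching_indepP indaK := G_indep aKG.
apply/matching_indepP => x y; rewrite !(in_setU1 _ b) => /orP[/eqP ->|xK] /orP[/eqP ->|yK] //.
- by move=> E; move: (yb _ yK); rewrite E eqxx.
- by move=> E; move: (yb _ xK); rewrite E eqxx.
exact: indaK.
Qed.

(** A member [C] avoiding [a] must contain [star b]. Further transitions sharing [K] are then tested
    against suitable members until two requirements clash. *)
Lemma transition_full a (K : {set matching_vertex n}) b C :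
  t < n -> transition a K b -> C \in G -> a \in C.
Proof.
move=> tn tr CG; apply: contraT => aC; have sbC := transition_star tr CG aC.
case: (tr) => indX aK baK aKG bKG.
have tK : #|K|.+1 = t by rewrite -(G_card aKG) cardsU1 aK.
have bN y : y \in a |: K -> y.1 != b.1.
  move=> yK; apply: contraNneq baK => E; have /matching_indepP indP := indX.
  by rewrite -(indP y b) // ?setU11 // setU1r.
have aN y : y \in K -> y.1 != a.1.
  move=> yK; apply: contraNneq aK => E; have /matching_indepP indP := G_indep aKG.
  by rewrite -(indP y a) // ?setU11 // setU1r.
have ab1 : a.1 != b.1 by apply: bN; rewrite setU11.
have bNK y : y \in K -> y.1 != b.1 by move=> yK; apply: bN; rewrite setU1r.
have notin1 (u w : matching_vertex n) (Y : {set matching_vertex n}) :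
    u.1 != w.1 -> (forall y, y \in Y -> y.1 != u.1) -> u \notin w |: Y.
  move=> uw uY; rewrite in_setU1 negb_or; apply/andP; split.
    by apply: contraNneq uw => ->.
  by apply/negP => /uY; rewrite eqxx.
(* Otherwise [star b] also ends a transition from [a], and [C] would contain both endpoints of one
   edge. *)
have sbKG : star b |: K \in G.
  apply: contraT => nG; have /transition_star : transition a K (star b).
    exact: transition_intro.
  move/(_ C CG aC); rewrite starK => bC.
  by case: (indep_starF (G_indep CG) bC).
case: (ltnP t.+1 n) => [t1n|t1n].
  (* There is room for an edge [i] free of [a], [K] and [b]. Testing against [star b |: K] puts both
     endpoints of [i], joined to [K], into [G]; then the transition from one endpoint to [b] fails
     on the other. *)
  have [i iN] : exists i, i \notin [set y.1 | y in b |: (a |: K)].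
    apply/existsP; rewrite -negb_forall; apply/negP => /forallP allI.
    have : n <= #|b |: (a |: K)|.
      rewrite -[X in X <= _]card_ord -cardsT.
      apply: leq_trans (leq_imset_card fst _).
      by apply: subset_leq_card; apply/subsetP => i _; apply: allI.
    by rewrite cardsU1 baK (G_card aKG) add1n leqNgt t1n.
  have iX y : y \in b |: (a |: K) -> y.1 != i.
    by move=> yX; apply: contraNneq iN => <-; apply: imset_f.
  have iK y : y \in K -> y.1 != i by move=> yK; apply: iX; rewrite !inE yK !orbT.
  have ib : b.1 != i by apply: iX; rewrite !inE eqxx.
  have ia : a.1 != i by apply: iX; rewrite !inE eqxx orbT.
  have cKG c : c.1 = i -> c |: K \in G.
    move=> ci; apply: contraT => nG; have /transition_star : transition a K c.
      apply: transition_intro => // y; rewrite in_setU1 ci => /orP[/eqP -> //|].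
      exact: iK.
    move/(_ _ sbKG); rewrite (negbTE (notin1 a _ _ _ aN)) // => /(_ isT).
    apply: contraLR => _; apply: notin1; rewrite star1 ci // eq_sym.
    exact: ib.
  pose c : matching_vertex n := (i, true).
  have /transition_star : transition c K b.
    apply: transition_intro (cKG _ _) _ => //; first by apply/negP => /iK; rewrite eqxx.
    by move=> y; rewrite in_setU1 => /orP[/eqP ->|/bNK //]; rewrite /= eq_sym.
  move/(_ _ (cKG (star c) erefl)); rewrite in_setU1 negb_or eq_sym star_neq /=.
  have -> : c \notin K by apply/negP => /iK; rewrite eqxx.
  by move/(_ isT); rewrite (negbTE (notin1 _ _ _ _ _)).
(* Otherwise the transition from [star a] to [b] would force [star b] into [a |: K]. *)
have saKG : star a |: K \notin G.
  apply/negP => saKG; have /transition_star : transition (star a) K b.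
    apply: transition_intro => //; first by apply/negP => /aN; rewrite eqxx.
    by move=> y; rewrite in_setU1 => /orP[/eqP ->|/bNK].
  move/(_ _ aKG); rewrite in_setU1 negb_or star_neq /=.
  have -> : star a \notin K by apply/negP => /aN; rewrite eqxx.
  by move/(_ isT); rewrite (negbTE (notin1 _ _ _ _ _)) // eq_sym.
(* In the order a, K*, b* the four arcs {a} + K*, K* + {b*}, {a*} + K and
   K + {b} cover all vertices, and none of them belongs to G. *)
have tn1 : t.+1 = n by apply/eqP; rewrite eqn_leq tn t1n.
pose L := a :: map (@star n) (enum K) ++ [:: star b].
have sL : size L = n by rewrite /= size_cat size_map -cardE addn1 tK.
have uL : uniq (map fst L).
  have -> : map fst L = map fst (a :: enum K ++ [:: b]).
    by rewrite /= !map_cat -map_comp.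
  apply: (indep_uniq_fst indX).
    by move=> u; rewrite inE mem_cat mem_enum !inE => /or3P[] ->; rewrite ?orbT.
  rewrite /= cat_uniq enum_uniq mem_cat mem_enum /= (negbTE aK) !inE orbF mem_enum.
  by rewrite in_setU1 negb_or eq_sym in baK; case/andP: baK => -> ->.
have [v vP vE] := antipodal_of_seq n_gt0 sL uL.
have vS : carc v 1 #|K| = @star n @: K.
  have := @arc_seq n v [:: a] (map (@star n) (enum K)) [:: star b] a.
  rewrite -/L sL => /(_ (vE a)); rewrite size_map -cardE => ->.
  apply/setP=> u; rewrite inE; apply/mapP/imsetP => -[w wK ->]; exists w => //.
    by rewrite -mem_enum.
  by rewrite mem_enum.
have v0 : v 0 = a by rewrite (vE a).
have vt : v t = star b.
  rewrite (vE a) ?tn1 // -tK /= nth_cat size_map -cardE ltnn subnn //.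
have arc0 : carc v 0 t = a |: @star n @: K by rewrite -tK arc_recl vS v0.
have arc1 : carc v 1 t = star b |: @star n @: K by rewrite -tK arc_recr vS add1n tK vt.
have ssK : @star n @: (@star n @: K) = K.
  by rewrite -imset_comp -[RHS]imset_id; apply: eq_imset => u /=; rewrite starK.
have arc2 : carc v (0 + n) t = star a |: K by rewrite arcDn // arc0 imsetU1 ssK.
have arc3 : carc v (1 + n) t = b |: K by rewrite arcDn // arc1 imsetU1 ssK starK.
have KsK u : u \in K -> u \in @star n @: K -> False.
  by move=> uK /imsetP[w wK E]; apply: indep_starF (G_indep aKG) (setU1r _ wK) _; rewrite -E setU1r.
have sK y : y \in @star n @: K -> exists2 w, w \in K & y.1 = w.1.
  by case/imsetP => w wK ->; exists w.
(* The arcs at 0 and 1 are excluded by [G_meet]: they are disjoint from the members [star b |: K]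
   and [a |: K] respectively. *)
have arc0G : carc v 0 t \notin G.
  rewrite arc0; apply/negP => /(G_meet sbKG)[u]; rewrite !in_setU1.
  case/orP=> [/eqP ->|uK] /orP[/eqP E|uS].
  - by move: ab1; rewrite -E eqxx.
  - by case/sK: uS => w /bNK; rewrite star1 => /negP h /eqP; rewrite eq_sym.
  - by move/aN: uK; rewrite E eqxx.
  - exact: KsK uK uS.
have arc1G : carc v 1 t \notin G.
  rewrite arc1; apply/negP => /(G_meet aKG)[u]; rewrite !in_setU1.
  case/orP=> [/eqP ->|uK] /orP[/eqP E|uS].
  - by move: ab1; rewrite E eqxx.
  - by case/sK: uS => w /aN /negP h /eqP; rewrite eq_sym.
  - by move/bNK: uK; rewrite E eqxx.
  - exact: KsK uK uS.
have [x xP] := G_star vP; have [q qn xE] := antipodal_onto vP 0 x; rewrite add0n in xE.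
have out m : carc v m t \notin G -> ~~ (m <= q < m + t).
  by move=> nG; apply: contra nG => /(mem_arc v); rewrite -xE -xP.
have : [|| 0 <= q < 0 + t, 1 <= q < 1 + t, 0 + n <= q < 0 + n + t |
          1 + n <= q < 1 + n + t].
  by clear -qn tn1 t_gt0; lia.
rewrite (negbTE (out _ arc0G)) (negbTE (out _ arc1G)).
by rewrite (negbTE (out (0 + n) _)) ?arc2 // (negbTE (out (1 + n) _)) ?arc3.
Qed.

(** Place [C] as an arc starting with [a]. If the vertex of this circle were not [a], some arc
    through it would avoid [a] and yet belong to [G]. *)
Lemma G_full_star a : (forall C, C \in G -> a \in C) ->
  forall C, indep (@matching n) C -> #|C| = t -> (C \in G) = (a \in C).
Proof.
move=> aG C indC tC; apply/idP/idP => [/aG //|aC].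
have uL : uniq (a :: enum (C :\ a)) by rewrite /= mem_enum !inE eqxx enum_uniq.
have LX : {subset a :: enum (C :\ a) <= C}.
  by move=> u; rewrite inE mem_enum !inE => /orP[/eqP ->|/andP[]].
have [|v [vP vE _]] := @antipodal_extend n _ predT a n_gt0 (indep_uniq_fst indC LX uL).
  by [].
have arc0 : carc v 0 t = C.
  have := @arc_seq n v [::] (a :: enum (C :\ a)) [::] a; rewrite cats0 => /(_ vE) /=.
  have -> : (size (enum (C :\ a))).+1 = t by rewrite -cardE -tC (cardsD1 a C) aC.
  move=> ->.
  by apply/setP=> u; rewrite !inE mem_enum !inE; case: eqP => // ->.
have v0 : v 0 = a by rewrite vE.
have [x xP] := G_star vP; have [q qn xE] := antipodal_onto vP 0 x.
rewrite add0n in xE; case: (posnP q) => [q0|q0]; first by rewrite -arc0 xP xE q0 mem_arc.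
(* The bounds $0 < m \le 2n - t$ say that the arc at [m] stops before returning to position 0, where
   [a] lies. *)
suff [m [mq n0m]] : exists m, m <= q < m + t /\ 0 < m <= 2 * n - t.
  have : a \in carc v m t by apply: aG; rewrite xP xE mem_arc.
  rewrite -v0 -(antipodalDN vP) => /arcP[i it].
  have -> : 0 + 2 * n = m + (2 * n - m) by lia.
  by move/(antipodal_inj vP); lia.
by case: (leqP (q + t) (2 * n)) => h; [exists q|exists (q.+1 - t)]; lia.
Qed.

(** On any circle, rotate its vertex to position 0. The arc at 0 is in [G] and the arc at 1 is not,
    which yields the pair [a |: K], [b |: K] needed above; for $t = n$, [b] is [star a]. *)
Lemma G_star_exists : exists a,
  forall C, indep (@matching n) C -> #|C| = t -> (C \in G) = (a \in C).
Proof.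
suff [a aG] : exists a, forall C, C \in G -> a \in C by exists a; apply: G_full_star.
pose v0 : matching_vertex n := (Ordinal n_gt0, true).
have [|v' [vP' _ _]] := @antipodal_extend n [::] predT v0 n_gt0 isT; first by [].
have [x xP] := G_star vP'; have [q _ xE] := antipodal_onto vP' 0 x.
rewrite add0n in xE; pose v j := v' (q + j).
have vP : antipodal v by apply: antipodal_shift.
have arcv m l : carc v m l = carc v' (q + m) l by apply: arc_shift.
pose a := v 0; pose K := carc v 1 t.-1; pose b := v t.
have arc0 : carc v 0 t = a |: K by rewrite -{1}(prednK t_gt0) arc_recl.
have arc1 : carc v 1 t = b |: K by rewrite -{1}(prednK t_gt0) arc_recr add1n prednK.
have aX : a = x by rewrite xE /a /v addn0.
have aKG : a |: K \in G by rewrite -arc0 arcv xP -arcv arc0 -aX setU11.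
have aN l : l < 2 * n -> a \notin carc v 1 l.
  move=> l2; apply/negP => /arcP[i il E].
  by have := @antipodal_inj n v vP 0 0 i.+1 ltac:(lia) ltac:(lia) E.
have aK : a \notin K by apply: aN; lia.
have bKG : b |: K \notin G by rewrite -arc1 arcv xP -arcv -aX aN //; lia.
exists a => C0 C0G; case: (leqP n t) => [tn|tn].
  have tn' : t = n by apply/eqP; rewrite eqn_leq t_le.
  have sab : star a = b by rewrite /b tn'; have := antipodalD vP 0; rewrite add0n.
  by apply: (full_transition tn' aK aKG _ C0G); rewrite sab.
apply: (@transition_full a K b) => //.
have indX : indep (@matching n) (b |: (a |: K)).
  by rewrite -arc0 -arc_recr; apply: indep_arc.
have baK : b \notin a |: K.
  rewrite -arc0; apply/negP => /arcP[i it E].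
  have := @antipodal_inj n v vP 0 t i ltac:(lia) ltac:(lia) E; lia.
by split.
Qed.

End Gluing.

(** * The family $\mathscr{P}^r(M_n)$ and its arcs *)

Lemma card_indep_le n (A : {set matching_vertex n}) :
  indep (@matching n) A -> #|A| <= n.
Proof.
move/matching_indepP => indA; rewrite -[X in _ <= X]card_ord.
by rewrite -(@card_in_imset _ _ fst A indA) max_card.
Qed.

Lemma alpha_matching n : alpha (@matching n) = n.
Proof.
apply/eqP; rewrite eqn_leq; apply/andP; split.
  by apply/bigmax_leqP => A; apply: card_indep_le.
pose A : {set matching_vertex n} := [set (i, true) | i : 'I_n].
have cA : #|A| = n by rewrite card_imset ?card_ord // => i j [].
rewrite -[X in X <= _]cA; apply: leq_bigmax_cond.
by apply/matching_indepP => _ _ /imsetP[i _ ->] /imsetP[j _ ->] /= ->.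
Qed.

(** An independent set of size $\alpha(M_n) = n$ picks one endpoint of every edge, so containing one
    means that no edge lies in the complement. *)
Lemma famM_matching n (A : {set matching_vertex n}) :
  (A \in famM (@matching n)) = indep (@matching n) (~: A).
Proof.
rewrite inE alpha_matching; apply/existsP/idP => [[B /and3P[BA indB /eqP cB]]|indA].
  have onB i : exists2 u, u \in B & u.1 = i.
    have /matching_indepP injB := indB.
    have : [set u.1 | u in B] == setT.
      by rewrite eqEcard subsetT cardsT card_ord (@card_in_imset _ _ fst B injB) cB leqnn.
    by move/eqP/setP/(_ i); rewrite inE => /imsetP[u uB ->]; exists u.
  apply/matching_indepP => x y; rewrite !inE => xA yA e1.
  case: (eq_or_star e1) => // xy; have [u uB u1] := onB y.1.
  by case: (eq_or_star u1) => E; move: (subsetP BA u uB); rewrite E -?xy ?(negbTE xA) ?(negbTE yA).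
pose s i : matching_vertex n := (i, (i, true) \in A).
exists [set s i | i : 'I_n]; apply/and3P; split.
- apply/subsetP => _ /imsetP[i _ ->]; apply: contraT => sA; move: (sA).
  rewrite /s; case: (boolP ((i, true) \in A)) => [-> //|tA fA].
  have /matching_indepP/(_ (i, true) (i, false)) := indA.
  by rewrite !inE tA fA => /(_ isT isT erefl).
- by apply/matching_indepP => _ _ /imsetP[i _ ->] /imsetP[j _ ->] /= ->.
by rewrite card_imset ?card_ord // => i j [].
Qed.

(** A set of [famM] with at most $n$ elements equals the independent $n$-set inside it, while no
    independent set has more than $n$ elements. *)
Lemma famPr_matching n r (A : {set matching_vertex n}) :
  (A \in famPr (@matching n) r) =
  (#|A| == r) && indep (@matching n) (if r <= n then A else ~: A).
Proof.
rewrite inE andbC; case: eqP => //= cA.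
rewrite in_setU famM_matching [A \in famI _]inE.
case: leqP => rn; last first.
  by case: (boolP (indep _ A)) => // /card_indep_le; rewrite cA leqNgt rn.
apply: orb_idr => indCA.
have : A \in famM (@matching n) by rewrite famM_matching.
rewrite inE alpha_matching => /existsP[B /and3P[BA indB /eqP cB]].
suff -> : A = B by [].
by apply/esym/eqP; rewrite eqEcard BA cB cA.
Qed.

Lemma indep_eq_carc n (C : {set matching_vertex n}) : 0 < n ->
  indep (@matching n) C -> exists2 v, antipodal v & carc v 0 #|C| = C.
Proof.
move=> n0 indC; pose x0 : matching_vertex n := (Ordinal n0, true).
have uL : uniq (map fst (enum C)).
  by apply: (indep_uniq_fst indC); rewrite ?enum_uniq // => u; rewrite mem_enum.
have [|v [vP vE _]] := @antipodal_extend n _ predT x0 n0 uL; first by [].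
exists v => //; have := @arc_seq n v [::] (enum C) [::] x0.
rewrite cats0 => /(_ vE); rewrite -cardE => ->.
by apply/setP=> u; rewrite inE mem_enum.
Qed.

Lemma carc_eq n (v : nat -> matching_vertex n) m m' l :
  antipodal v -> v m = v m' -> carc v m l = carc v m' l.
Proof.
move=> vP /(antipodal_eq vP) E; apply: eq_imset => i.
by apply/(antipodal_eq vP); rewrite -modnDml E modnDml.
Qed.

Lemma carc_famPr n (v : nat -> matching_vertex n) m r :
  antipodal v -> r <= 2 * n -> carc v m r \in famPr (@matching n) r.
Proof.
move=> vP r2; rewrite famPr_matching card_arc // eqxx /=.
by case: leqP => rn; rewrite ?arc_setC //; apply: indep_arc => //; lia.
Qed.

Lemma carc_count_ge n (v : nat -> matching_vertex n) r x :
  antipodal v -> r <= 2 * n -> r <= \sum_(m < 2 * n) (x \in carc v m r).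
Proof.
move=> vP r2; have [q q2 ->] := antipodal_onto vP 0 x.
pose U m : bool := v q \in carc v m r.
have perU m : U (m + 2 * n) = U m by rewrite /U arcDN.
(* The shift moves to the first of the [r] consecutive starts whose arcs contain position
   [q + 2 * n]; adding a full turn keeps the subtraction from truncating. *)
rewrite add0n -(periodic_sum perU (q + 2 * n + 1 - r)).
rewrite -[X in X <= _]card_ord -sum1_card (big_ord_widen _ (fun=> 1) r2) big_mkcond /=.
apply: leq_sum => p _; case: ltnP => // pr.
by rewrite /U -(antipodalDN vP q) mem_arc //; lia.
Qed.

(** * A $k$-wise intersecting family on one circle *)

Section KwiseOnCycle.

Variables (n k r : nat) (F : {set {set matching_vertex n}}).
Hypotheses (k_gt1 : 1 < k) (r_gt0 : 0 < r) (r_lt : r < 2 * n).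
Hypothesis r_le : 2 * n <= k * (2 * n - r).
Hypothesis F_kwise : kwise_intersecting k F.
Variable v : nat -> matching_vertex n.
Hypothesis vP : antipodal v.

Let s := 2 * n - r.
Let U m := carc v (m + s) r \in F.

Let U_periodic m : U (m + 2 * n) = U m.
Proof. by rewrite /U addnAC arcDN. Qed.

(* The complement of the arc of length r at m + s is the arc of length s at m,
   so members of F with a common vertex have complements that do not cover. *)
Let U_no_cover (b : nat) (f : 'I_k -> nat) : (forall i, U (f i)) ->
  exists2 p, p < 2 * n & forall i d, d < s -> f i + d <> b + p %[mod 2 * n].
Proof.
move=> Uf; have /set0Pn[x /bigcapP xF] := F_kwise Uf.
have [p p2 xE] := antipodal_onto vP b x; exists p => // i d ds E.
have /arcP[j jr] := xF i isT; rewrite xE.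
move/(antipodal_eq vP): E => <-; rewrite -addnA => /(antipodal_inj vP); rewrite /s in ds *; lia.
Qed.

Let sumU : \sum_(m < 2 * n) (carc v m r \in F) = \sum_(m < 2 * n) U m.
Proof.
pose W m : bool := carc v m r \in F.
have perW m : W (m + 2 * n) = W m by rewrite /W arcDN.
rewrite -[LHS](periodic_sum perW s); apply: eq_bigr => p _.
by rewrite /W /U addnC.
Qed.

Let s_gt0 : 0 < s. Proof. by rewrite subn_gt0. Qed.

Lemma kwise_cycle_le : \sum_(m < 2 * n) (carc v m r \in F) <= r.
Proof.
have := periodic_count_le s_gt0 k_gt1 r_le U_periodic U_no_cover (leq_subr _ _).
by rewrite sumU subKn // ltnW.
Qed.

Lemma kwise_cycle_eq : 2 * n < k * (2 * n - r) ->
  \sum_(m < 2 * n) (carc v m r \in F) = r ->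
  exists x, forall m, (carc v m r \in F) = (x \in carc v m r).
Proof.
move=> lt; rewrite sumU => E.
have s2 : s < 2 * n by rewrite /s; lia.
have [|b bP] := periodic_count_eq s_gt0 k_gt1 r_le U_periodic U_no_cover s2 lt.
  by rewrite E /s; lia.
(* The arc starting [p] steps after [b + s] fails to reach [b + s] again exactly when $0 < p \le s$,
   the offsets missing from [U]. *)
exists (v (b + s)) => m; have [p p2 mE] := antipodal_onto vP (b + s) (v m).
rewrite (carc_eq r vP mE); have := bP p p2; rewrite /U addnAC => ->.
case: (posnP p) => [->|p0]; first by rewrite addn0 mem_arc //; lia.
rewrite -(antipodalDN vP (b + s)).
have -> : b + s + 2 * n = b + s + p + (2 * n - p) by lia.
rewrite mem_arcE //; rewrite /s; lia.
Qed.

End KwiseOnCycle.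

(** * Averaging over all antipodal orders *)

Section Averaging.

Variables (n : nat) (n_gt0 : 0 < n).

Definition base_order j : matching_vertex n :=
  (Ordinal (ltn_pmod j n_gt0), odd (j %/ n)).

Lemma base_antipodal : antipodal base_order.
Proof.
split=> [j|i j []] //; congr (_, _); first by apply: val_inj; rewrite /= modnDr.
by rewrite divnDr // divnn n_gt0 addn1.
Qed.

(** This is the automorphism group of $M_n$; it carries [base_order] to every antipodal order, so
    averaging over orders becomes a sum over [H]. *)
Definition hyperoctahedral : {set {perm matching_vertex n}} :=
  [set s : {perm matching_vertex n} | [forall u, s (star u) == star (s u)]].

Local Notation H := hyperoctahedral.

Lemma hyperoctP (s : {perm matching_vertex n}) :
  reflect (forall u, s (star u) = star (s u)) (s \in H).
Proof. by rewrite inE; apply: (iffP forallP) => h u; apply/eqP/h. Qed.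

Lemma hyperoctM s h : h \in H -> ((s * h)%g \in H) = (s \in H).
Proof.
move=> /hyperoctP hH; apply/hyperoctP/hyperoctP => sH u; last by rewrite !permM sH hH.
by have := sH u; rewrite !permM -hH => /perm_inj.
Qed.

Lemma hyperoctV s : s \in H -> s^-1%g \in H.
Proof.
move=> /hyperoctP sH; apply/hyperoctP => u; apply: (@perm_inj _ s).
by rewrite sH !permKV.
Qed.

Lemma hyperoct_antipodal s : s \in H -> antipodal (s \o base_order).
Proof.
move=> /hyperoctP sH; split=> [j|i j] /=; first by rewrite (antipodalD base_antipodal) sH.
move=> E; apply/(antipodal_eq1 base_antipodal).
case: (eq_or_star E); last rewrite -sH; by move/perm_inj ->.
Qed.

Lemma antipodal_hyperoct v : antipodal v ->
  exists2 s, s \in H & v =1 s \o base_order.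
Proof.
move=> vP; pose g (u : matching_vertex n) := v (u.1 + u.2 * n).
have gb : g \o base_order =1 v.
  move=> j; rewrite /g /= (antipodalM vP) oddb.
  by rewrite [in RHS](divn_eq j n) addnC (antipodalM vP).
have gI : injective g.
  move=> [i a] [j b] /=; rewrite /g /=.
  have := ltn_ord i; have := ltn_ord j => jn iN E.
  have := @antipodal_inj n v vP 0 (i + a * n) (j + b * n).
  case: a b E => [] [] E /(_ ltac:(lia) ltac:(lia) E) E2;
    by [congr (_, _); apply: val_inj => /=; lia|lia].
exists (perm gI) => [|j]; last by rewrite /= permE -gb.
apply/hyperoctP => -[i b]; rewrite !permE /g /= -(antipodalD vP).
by case: b; rewrite /= ?mul1n ?mul0n ?addn0 // -addnA addnn -mul2n antipodalDN.
Qed.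

Lemma carc_comp (s : {perm matching_vertex n}) v m l :
  carc (s \o v) m l = s @: carc v m l.
Proof. by rewrite -imset_comp. Qed.

Variable r : nat.
Hypothesis r_le : r <= 2 * n.

Local Notation P := (famPr (@matching n) r).

Lemma famPr_carc : exists m, forall A, A \in P ->
  exists2 s : {perm matching_vertex n}, s \in H & A = s @: carc base_order m r.
Proof.
(* For $r > n$ the complement of [A] is realized as the arc of length $2n - r$ at 0, so [A] itself
   starts at $2n - r$. *)
case: (leqP r n) => rn; [exists 0|exists (2 * n - r)] => A; rewrite famPr_matching.
  rewrite rn => /andP[/eqP cA indA].
  have [v vP vE] := indep_eq_carc n_gt0 indA.
  have [s sH vs] := antipodal_hyperoct vP; exists s => //.
  by rewrite -{1}vE cA -carc_comp; apply: eq_imset => i; apply: vs.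
rewrite leqNgt rn => /andP[/eqP cA indA].
have [v vP vE] := indep_eq_carc n_gt0 indA.
have cCA : #|~: A| = 2 * n - r by rewrite -cA -card_matching_vertex -(cardsC A) addKn.
have [s sH vs] := antipodal_hyperoct vP; exists s => //.
rewrite -(setCK A) -{1}vE cCA arc_setC ?leq_subr // subKn //.
by rewrite -carc_comp; apply: eq_imset => i; apply: vs.
Qed.

Lemma famPr_trans A B : A \in P -> B \in P ->
  exists2 h : {perm matching_vertex n}, h \in H & B = h @: A.
Proof.
have [m mP] := famPr_carc => /mP[s sH ->] /mP[s' sH' ->].
exists (s^-1 * s')%g; first by rewrite hyperoctM ?hyperoctV.
by rewrite -imset_comp; apply: eq_imset => u; rewrite /= permM permK.
Qed.

Definition arc_incidences A :=
  \sum_(s in H) \sum_(m < 2 * n) (s @: carc base_order m r == A).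

(** Right multiplication by an [h] in [H] that maps [A] to [B] permutes [H] and matches the
    incidences. *)
Lemma arc_incidences_const A B : A \in P -> B \in P ->
  arc_incidences B = arc_incidences A.
Proof.
move=> AP BP; have [h hH ->] := famPr_trans AP BP.
rewrite /arc_incidences (reindex_inj (mulIg h)) /=.
apply: eq_big => [s|s _]; first exact: hyperoctM.
apply: eq_bigr => m _; congr (nat_of_bool _).
have -> : (s * h)%g @: carc base_order m r = h @: (s @: carc base_order m r).
  by rewrite -imset_comp; apply: eq_imset => u; rewrite /= permM.
by rewrite (inj_eq (imset_inj (@perm_inj _ h))).
Qed.

Lemma sum_arc_incidences (F : {set {set matching_vertex n}}) :
  \sum_(A in F) arc_incidences A =
  \sum_(s in H) \sum_(m < 2 * n) (carc (s \o base_order) m r \in F).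
Proof.
rewrite exchange_big; apply: eq_bigr => s _; rewrite exchange_big.
apply: eq_bigr => m _; rewrite carc_comp; set X := imset _ _.
case: (boolP (X \in F)) => XF.
  by rewrite (bigD1 X) //= eqxx big1 // => A /andP[_ /negbTE]; rewrite eq_sym => ->.
by rewrite big1 // => A AF; case: eqP => // XA; rewrite XA AF in XF.
Qed.

Lemma famPr_incidences (F : {set {set matching_vertex n}}) A :
  F \subset P -> A \in P ->
  #|F| * arc_incidences A =
  \sum_(s in H) \sum_(m < 2 * n) (carc (s \o base_order) m r \in F).
Proof.
move=> /subsetP FP AP; rewrite -sum_arc_incidences -sum_nat_const.
by apply: eq_bigr => B /FP BP; apply: arc_incidences_const.
Qed.

Lemma famPrx_incidences x A : A \in P ->
  #|H| * r <= #|famPrx (@matching n) r x| * arc_incidences A.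
Proof.
move=> AP; rewrite (famPr_incidences _ AP); last by apply/subsetP => B /setIdP[].
rewrite -sum_nat_const; apply: leq_sum => s sH.
have vP := hyperoct_antipodal sH.
apply: leq_trans (carc_count_ge x vP r_le) _; apply: leq_sum => m _.
by rewrite inE (carc_famPr _ vP r_le).
Qed.

Variable k : nat.
Hypotheses (k_gt1 : 1 < k) (r_gt0 : 0 < r) (r_lt : r < 2 * n).
Hypothesis r_lek : 2 * n <= k * (2 * n - r).
Variable F : {set {set matching_vertex n}}.
Hypotheses (F_sub : F \subset P) (F_kwise : kwise_intersecting k F).

Let A0 := carc base_order 0 r.
Let A0P : A0 \in P. Proof. exact: carc_famPr base_antipodal r_le. Qed.

Let F_le A : A \in P -> #|F| * arc_incidences A <= #|H| * r.
Proof.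
move=> AP; rewrite (famPr_incidences F_sub AP) -sum_nat_const.
apply: leq_sum => s sH.
exact: (kwise_cycle_le k_gt1 r_gt0 r_lt r_lek F_kwise (hyperoct_antipodal sH)).
Qed.

Let incidences_gt0 : 0 < arc_incidences A0.
Proof.
have x : matching_vertex n := (Ordinal n_gt0, true).
have : 0 < #|H| * r.
  rewrite muln_gt0 r_gt0 andbT; apply/card_gt0P; exists 1%g.
  by apply/hyperoctP => u; rewrite !perm1.
by move/leq_trans => /(_ _ (famPrx_incidences x A0P)); rewrite muln_gt0 => /andP[].
Qed.

(** Weighted by the common incidence number, [F] is at most [#|H| * r] and the star at [x] is at
    least that. *)
Lemma kwise_le_star x : #|F| <= #|famPrx (@matching n) r x|.
Proof.
rewrite -(leq_pmul2r incidences_gt0).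
exact: leq_trans (F_le A0P) (famPrx_incidences x A0P).
Qed.

(** Equal sizes make the counts over all orders add up to [#|H| * r]. Each count is at most [r],
    hence equal to [r], and [kwise_cycle_eq] applies. *)
Lemma kwise_eq_star x : 2 * n < k * (2 * n - r) ->
  #|F| = #|famPrx (@matching n) r x| ->
  forall v, antipodal v ->
  exists y, forall m, (carc v m r \in F) = (y \in carc v m r).
Proof.
move=> lt cF v vP; have [s sH vs] := antipodal_hyperoct vP.
apply: (kwise_cycle_eq k_gt1 r_gt0 r_lt r_lek F_kwise vP lt).
have leif s' : s' \in H ->
    \sum_(m < 2 * n) (carc (s' \o base_order) m r \in F) <= r ?= iff
    (\sum_(m < 2 * n) (carc (s' \o base_order) m r \in F) == r).
  move=> s'H; split=> //.
  exact: (kwise_cycle_le k_gt1 r_gt0 r_lt r_lek F_kwise (hyperoct_antipodal s'H)).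
have [_ E] := leqif_sum leif.
move: E; rewrite -(famPr_incidences F_sub A0P) sum_nat_const.
have -> : #|F| * arc_incidences A0 == #|H| * r.
  by rewrite eqn_leq (F_le A0P) cF famPrx_incidences.
move/esym/forall_inP/(_ s sH)/eqP => {2}<-.
apply: eq_bigr => m _; congr (nat_of_bool (_ \in F)).
by apply: eq_imset => i; apply: vs.
Qed.

End Averaging.

(** * The equality case for all $r$ *)

Lemma kwise_eq_famPrx n k r (F : {set {set matching_vertex n}}) x :
  0 < n -> 1 < k -> 0 < r -> r < 2 * n -> 2 * n < k * (2 * n - r) ->
  F \subset famPr (@matching n) r -> kwise_intersecting k F ->
  #|F| = #|famPrx (@matching n) r x| ->
  exists y, F = famPrx (@matching n) r y.
Proof.
move=> n0 k1 r0 r2 lt FP Fk cF.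
have starF := kwise_eq_star n0 (ltnW r2) k1 r0 r2 (ltnW lt) FP Fk lt cF.
have {}FP := subsetP FP.
case: (leqP r n) => rn.
  have [||a aP] := @G_star_exists n r F r0 rn _ _ starF.
  - by move=> C /FP; rewrite famPr_matching rn => /andP[].
  - by move=> C /FP; rewrite famPr_matching => /andP[/eqP].
  exists a; apply/setP=> A; rewrite inE.
  case: (boolP (A \in famPr _ _)) => [|/(contra (FP A))/negbTE //].
  by rewrite famPr_matching rn => /andP[/eqP cA indA]; rewrite aP.
set t := 2 * n - r.
(* An arc and its complement cannot both contain the vertex of the circle, so taking complements of
   non-members preserves that vertex. *)
pose G := [set C | [&& indep (@matching n) C, #|C| == t & ~: C \notin F]].
have tn : t <= n by rewrite /t; lia.
have t0 : 0 < t by rewrite subn_gt0.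
have [|||a aP] := @G_star_exists n t G t0 tn.
- by move=> C; rewrite inE => /and3P[].
- by move=> C; rewrite inE => /and3P[_ /eqP].
- move=> v vP; have [y yP] := starF v vP; exists y => m.
  have t2 : t <= 2 * n by apply: leq_subr.
  rewrite inE indep_arc // card_arc // eqxx /= -[in RHS](setCK (carc v m t)) inE.
  by rewrite arc_setC // /t subKn ?yP // ltnW.
exists a; apply/setP=> A; rewrite inE.
case: (boolP (A \in famPr _ _)) => [|/(contra (FP A))/negbTE //].
rewrite famPr_matching leqNgt rn /= => /andP[/eqP cA indA].
have cCA : #|~: A| = t by rewrite /t -cA -card_matching_vertex -(cardsC A) addKn.
by have := aP _ indA cCA; rewrite !inE indA cCA eqxx setCK /= => /negb_inj.
Qed.

(** * Sizes of $\mathscr{P}^r(M_n)$ and of its stars *)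

Lemma card_indep n t :
  #|[set A : {set matching_vertex n} | indep (@matching n) A & #|A| == t]| =
  2 ^ t * 'C(n, t).
Proof.
(* An independent set is encoded by the set of edges it meets and the subset of those met at the
   endpoint [true]. *)
pose g (p : {set 'I_n} * {set 'I_n}) : {set matching_vertex n} :=
  [set u | (u.1 \in p.1) && (u.2 == (u.1 \in p.2))].
have indg p : indep (@matching n) (g p).
  apply/matching_indepP => -[i a] [j b]; rewrite !inE /=.
  by move=> /andP[_ /eqP ->] /andP[_ /eqP ->] ->.
have fstg p : [set u.1 | u in g p] = p.1.
  apply/setP=> i; apply/imsetP/idP => [[u]|ip]; first by rewrite inE => /andP[up _] ->.
  by exists (i, i \in p.2); rewrite ?inE /= ?ip ?eqxx.
have cardg p : #|g p| = #|p.1|.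
  by rewrite -[in RHS]fstg card_in_imset //; apply/matching_indepP/indg.
pose S := [set p : {set 'I_n} * {set 'I_n} | (#|p.1| == t) && (p.2 \subset p.1)].
have -> : [set A : {set matching_vertex n} | indep (@matching n) A & #|A| == t] = g @: S.
  apply/setP=> A; rewrite inE; apply/andP/imsetP => [[indA cA]|[p]]; last first.
    by rewrite inE => /andP[cp _] ->; rewrite indg cardg.
  have /matching_indepP injA := indA.
  exists ([set u.1 | u in A], [set u.1 | u in A & u.2]).
    rewrite inE /= card_in_imset // cA; apply: imsetS.
    by apply/subsetP => u /setIdP[].
  apply/setP=> u; rewrite inE /=; apply/idP/andP => [uA|[/imsetP[w wA u1] /eqP u2]].
    split; first exact: imset_f.
    apply/eqP; case: (boolP u.2) => u2; apply/esym.
      by apply/imsetP; exists u; rewrite ?inE ?uA.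
    apply/negbTE/imsetP => -[w /setIdP[wA w2] u1].
    by move: u2; rewrite (injA _ _ uA wA u1) w2.
  case: (eq_or_star u1) => [-> //|us].
  move: u2; rewrite us /=; case: (boolP w.2) => w2 /=.
    by move/esym/negbT/negP; case; apply/imsetP; exists w; rewrite ?inE ?wA.
  move/esym/imsetP => [z /setIdP[zA z2] wz].
  by move: w2; rewrite (injA _ _ wA zA wz) z2.
rewrite card_in_imset; last first.
  move=> [I J] [I' J']; rewrite !inE /= => /andP[_ JI] /andP[_ JI'] E.
  have EI : I = I' by have := fstg (I, J); rewrite E fstg.
  subst I'; congr (_, _); apply/setP=> i; have /setP/(_ (i, true)) := E.
  rewrite !inE /=; case: (boolP (i \in I)) => iI /=; first by do 2 case: (i \in _).
  by rewrite (contraNF (subsetP JI i) iI) (contraNF (subsetP JI' i) iI).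
have -> : #|S| = \sum_(p : {set 'I_n} * {set 'I_n} | (#|p.1| == t) && (p.2 \subset p.1)) 1.
  by rewrite -sum1_card; apply: eq_bigl => p; rewrite inE.
rewrite -(pair_big_dep (fun I : {set 'I_n} => #|I| == t)
            (fun I J : {set 'I_n} => J \subset I) (fun _ _ => 1)) /=.
rewrite (eq_bigr (fun=> 2 ^ t)) => [|I /eqP <-].
  by rewrite sum_nat_cond_const card_draws card_ord mulnC.
by rewrite -card_powerset -sum1_card; apply: eq_bigl => J; rewrite powersetE.
Qed.

Lemma card_famPr n r : r <= 2 * n ->
  #|famPr (@matching n) r| =
  let t := if r <= n then r else 2 * n - r in 2 ^ t * 'C(n, t).
Proof.
move=> r2 /=; rewrite -card_indep; case: leqP => rn.
  by apply: eq_card => A; rewrite famPr_matching rn inE andbC.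
rewrite -(card_imset (mem (famPr _ r)) (@setC_inj _)); apply: eq_card => A.
have -> : (A \in [set ~: B | B in famPr (@matching n) r]) = (~: A \in famPr (@matching n) r).
  by rewrite -{1}(setCK A) mem_imset //; apply: setC_inj.
rewrite famPr_matching leqNgt rn /= setCK inE andbC; congr (_ && _).
by rewrite -(eqn_add2l #|A|) cardsC card_matching_vertex -[RHS](eqn_add2r r) subnK // eq_sym.
Qed.

Lemma famPrx_kwise n k r x : 0 < k -> kwise_intersecting k (famPrx (@matching n) r x).
Proof.
move=> k0 f fP; apply/set0Pn; exists x; apply/bigcapP => i _.
by have := fP i; rewrite inE => /andP[].
Qed.

Lemma sum_famPrx n r :
  \sum_x #|famPrx (@matching n) r x| = r * #|famPr (@matching n) r|.
Proof.
rewrite (eq_bigr (fun x => \sum_(A in famPr (@matching n) r) (x \in A))) => [|x _].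
  rewrite exchange_big mulnC -sum_nat_const; apply: eq_bigr => A.
  rewrite famPr_matching => /andP[/eqP <- _].
  by rewrite -sum1_card [RHS]big_mkcond; apply: eq_bigr => x _; case: (x \in A).
rewrite -sum1_card big_mkcond [RHS]big_mkcond; apply: eq_bigr => A _.
by rewrite inE; case: (A \in _); case: (x \in A).
Qed.

(** Stars are themselves $k$-wise intersecting, so [kwise_le_star] applied both ways shows that they
    all have one size. Counting pairs of a vertex and a set containing it then gives this size from
    [card_famPr]. *)
Lemma card_famPrx n k r x :
  0 < n -> 1 < k -> 0 < r -> r < 2 * n -> 2 * n <= k * (2 * n - r) ->
  #|famPrx (@matching n) r x| =
    if r <= n then 2 ^ (r - 1) * 'C(n - 1, r - 1)
    else 2 ^ (2 * n - r) * 'C(n - 1, 2 * n - r)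
         + 2 ^ (2 * n - r - 1) * 'C(n - 1, 2 * n - r - 1).
Proof.
move=> n0 k1 r0 r2 rk.
have sub z : famPrx (@matching n) r z \subset famPr (@matching n) r.
  by apply/subsetP => A; rewrite inE => /andP[].
have le y z : #|famPrx (@matching n) r y| <= #|famPrx (@matching n) r z|.
  apply: (kwise_le_star n0 (ltnW r2) k1 r0 r2 rk (sub y)).
  exact: famPrx_kwise (ltnW k1).
have := sum_famPrx n r; rewrite (eq_bigr (fun=> #|famPrx (@matching n) r x|)); last first.
  by move=> y _; apply/eqP; rewrite eqn_leq !le.
rewrite sum_nat_const card_matching_vertex (card_famPr (ltnW r2)) /= => E.
have n2 : 0 < 2 * n by rewrite muln_gt0.
apply/eqP; rewrite -(eqn_pmul2l n2) E; apply/eqP.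
case: leqP => rn.
  case: r r0 {r2 rk sub le E rn} => // r _; rewrite subSS subn0 subn1.
  by rewrite mulnCA -mul_bin_diag expnS; lia.
set t := 2 * n - r.
have rE : r = 2 * n - t by rewrite subKn // ltnW.
have tn : t < n by rewrite /t; lia.
have t0 : 0 < t by rewrite subn_gt0.
rewrite rE; clearbody t; clear -tn t0.
case: t t0 tn => // t _; case: n => // n tn.
(* The identity to prove splits by $2n - t$: the part with $t$ is absorbed by $t\binom{n}{t} =
   n\binom{n-1}{t-1}$, the part with $2n$ by Pascal's rule. *)
have D := mul_bin_diag n.+1 t; rewrite /= binS in D.
rewrite !subn1 !succnK expnS binS mulnBl.
have -> : t.+1 * (2 * 2 ^ t * ('C(n, t.+1) + 'C(n, t))) = 2 * 2 ^ t * (n.+1 * 'C(n, t)).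
  by rewrite D mulnCA.
by lia.
Qed.

(** * Clearing denominators and the final theorem *)

Lemma rat_le_sub n k r : 1 < k ->
  ((r%:R <= (k%:R - 1) * (2 * n%:R) / k%:R :> rat)%R = (r * k <= (k - 1) * (2 * n))) *
  ((r%:R < (k%:R - 1) * (2 * n%:R) / k%:R :> rat)%R = (r * k < (k - 1) * (2 * n))).
Proof.
move=> k1; have k0 : (0 < k%:R :> rat)%R by rewrite Num.Theory.ltr0n ltnW.
rewrite Num.Theory.ler_pdivlMr // Num.Theory.ltr_pdivlMr //.
by rewrite -(@GRing.natrB _ k 1) ?(ltnW k1) // -!GRing.natrM Num.Theory.ler_nat Num.Theory.ltr_nat.
Qed.

Theorem theorem1p3 (n k r : nat) (hn : 1 <= n) (hk : 2 <= k) (hr : 0 < r)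
    (hrk : (r%:R <= (k%:R - 1) * (2 * n%:R) / k%:R :> rat)%R)
    (F : {set {set matching_vertex n}})
    (hF : F \subset famPr (@matching n) r)
    (hFk : kwise_intersecting k F) :
  let bound :=
    if r <= n then 2 ^ (r - 1) * 'C(n - 1, r - 1)
    else 2 ^ (2 * n - r) * 'C(n - 1, 2 * n - r)
         + 2 ^ (2 * n - r - 1) * 'C(n - 1, 2 * n - r - 1) in
  #|F| <= bound /\
  ((r%:R < (k%:R - 1) * (2 * n%:R) / k%:R :> rat)%R ->
   (#|F| = bound <->
    exists x : matching_vertex n, F = famPrx (@matching n) r x)).
Proof.
move=> bound; move: hrk; rewrite !rat_le_sub // => rk.
(* On complements, the bound on $r$ says that the lengths of $k$ arcs of $2n - r$ vertices add up to
   at least $2n$. *)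
have rk' : 2 * n <= k * (2 * n - r) by nia.
have r2 : r < 2 * n by nia.
have boundE x : #|famPrx (@matching n) r x| = bound.
  exact: card_famPrx hn hk hr r2 rk'.
pose x0 : matching_vertex n := (Ordinal hn, true).
split; first by rewrite -(boundE x0); exact (kwise_le_star hn (ltnW r2) hk hr r2 rk' hF hFk x0).
move=> lt; split=> [cF|[x ->] //].
apply: (@kwise_eq_famPrx n k r F x0) => //; first by nia.
by rewrite boundE.
Qed.
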